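(* Let $K$ be a cubic extension of $\mathbb{Q}$ and let $\lambda\in K$ with $\lambda\neq 0,1$. Then the elliptic curve $E\colon y^2=x(x-1)(x-\lambda)$ has infinite rank over $K\mathbb{Q}^{\mathrm{ab}}$.
   Context: $\mathbb{Q}^{\mathrm{ab}}$ denotes the maximal abelian extension of $\mathbb{Q}$ inside a fixed algebraic closure $\overline{\mathbb{Q}}$, $K\subset\overline{\mathbb{Q}}$, and $K\mathbb{Q}^{\mathrm{ab}}$ is the compositum of $K$ and $\mathbb{Q}^{\mathrm{ab}}$ in $\overline{\mathbb{Q}}$. An elliptic curve $E$ has infinite rank over a field $F$ if $E(F)\otimes_{\mathbb{Z}}\mathbb{Q}$ is infinite-dimensional over $\mathbb{Q}$. *)

(* Defs.v *)
From HB Require Import structures.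
From mathcomp Require Import all_boot all_order all_algebra all_fingroup.
From mathcomp Require Import all_solvable all_field generic_quotient.
From mathcomp Require Import ring_quotient boolp freeg.
From mathcomp Require Import ring.

Set Implicit Arguments.
Unset Strict Implicit.
Unset Printing Implicit Defensive.

Import GRing.Theory.
Local Open Scope ring_scope.

Definition field_image (L : fieldExtType rat) (f : {rmorphism L -> algC}) :
    {pred algC} :=
  fun z => `[< exists x : L, z = f x >].

(** [algC] is the fixed algebraic closure of the rationals; inside it, the
    maximal abelian extension is the union of all finite abelian extensions. *)
Definition Qab : {pred algC} :=
  fun z => `[< exists (L : splittingFieldType rat) (f : {rmorphism L -> algC}),
    [/\ galois 1%AS {:L}, abelian 'Gal({:L} / 1%AS) & z \in field_image f] >].

Section Compositum.

Variables A B : {pred algC}.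

Definition in_compositum : {pred algC} :=
  fun z => `[< forall F : {pred algC}, divring_closed F ->
    {subset A <= F} -> {subset B <= F} -> z \in F >].

Lemma sub_compositum_l : {subset A <= in_compositum}.
Proof. by move=> z Az; apply/asboolP => F _ AF _; apply: AF. Qed.

Lemma sub_compositum_r : {subset B <= in_compositum}.
Proof. by move=> z Bz; apply/asboolP => F _ _ BF; apply: BF. Qed.

Lemma in_compositum_divring_closed : divring_closed in_compositum.
Proof.
split=> [|x y /asboolP xF /asboolP yF|x y /asboolP xF /asboolP yF];
  apply/asboolP => F clF AF BF; have [F1 FB FM] := clF => //.
  by apply: FB; [apply: xF | apply: yF].
by apply: FM; [apply: xF | apply: yF].
Qed.

HB.instance Definition _ :=
  GRing.isDivringClosed.Build algC in_compositum in_compositum_divring_closed.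

Definition compositum : Type := {z : algC | z \in in_compositum}.

HB.instance Definition _ := SubChoice.on compositum.
HB.instance Definition _ :=
  [SubChoice_isSubIntegralDomain of compositum by <:].
HB.instance Definition _ := [SubIntegralDomain_isSubField of compositum by <:].

End Compositum.

Lemma field_image_in (L : fieldExtType rat) (f : {rmorphism L -> algC})
  (x : L) : f x \in field_image f.
Proof. by apply/asboolP; exists x. Qed.

Definition KQab (K : fieldExtType rat) (iota : {rmorphism K -> algC}) :
    fieldType :=
  compositum (field_image iota) Qab.

Definition to_KQab (K : fieldExtType rat) (iota : {rmorphism K -> algC})
    (x : K) : KQab iota :=
  exist _ (iota x) (sub_compositum_l Qab (field_image_in iota x)).

Section Legendre.

Variables (F : fieldType) (lambda : F).

(** [None] is the point at infinity, the neutral element of the group law. *)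
Definition on_legendre (P : option (F * F)) : bool :=
  if P is Some (x, y) then y ^+ 2 == x * (x - 1) * (x - lambda) else true.

Definition legendre_pt : Type := {P : option (F * F) | on_legendre P}.

HB.instance Definition _ := Choice.on legendre_pt.

(** The line of slope [m] through (x1, y1) meets the curve in points whose
    abscissas add up to m^2 + 1 + lambda; two of them are [x1] and [x2], and
    the third point is reflected in the x-axis. *)
Definition legendre_chord (m x1 y1 x2 : F) : option (F * F) :=
  let x3 := m ^+ 2 + 1 + lambda - x1 - x2 in
  Some (x3, - (y1 + m * (x3 - x1))).

Definition legendre_add (P Q : option (F * F)) : option (F * F) :=
  match P, Q with
  | None, _ => Q
  | _, None => P
  | Some (x1, y1), Some (x2, y2) =>
      if x1 != x2 then legendre_chord ((y2 - y1) / (x2 - x1)) x1 y1 x2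
      else if y1 == - y2 then None
      else legendre_chord
             ((3 * x1 ^+ 2 - 2 * (1 + lambda) * x1 + lambda) / (2 * y1))
             x1 y1 x1
  end.

Lemma legendre_add_on P Q :
  on_legendre P -> on_legendre Q -> on_legendre (legendre_add P Q).
Proof.
case: P Q => [[x1 y1]|] [[x2 y2]|] //= /eqP E1 /eqP E2.
have [x12|nx] /= := eqVneq x1 x2.
  case: ifPn => // ny /=; subst x2.
  have y12 : y1 = y2.
    apply/eqP; rewrite -subr_eq0.
    have : (y1 - y2) * (y1 + y2) == 0 by rewrite -subr_sqr E1 E2 subrr.
    by rewrite mulf_eq0 [y1 + y2 == 0]addr_eq0 (negPf ny) orbF.
  subst y2.
  have n2y : 2 * y1 != 0.
    by apply: contra ny; rewrite mulr_natl mulr2n addr_eq0.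
  set m := _ / _.
  have Em : 2 * y1 * m = 3 * x1 ^+ 2 - 2 * (1 + lambda) * x1 + lambda.
    by rewrite /m mulrC divfK.
  set x3 := m ^+ 2 + 1 + lambda - x1 - x1.
  rewrite -subr_eq0; apply/eqP.
  transitivity ((y1 ^+ 2 - x1 * (x1 - 1) * (x1 - lambda)) + (2 * y1 * m -
    (3 * x1 ^+ 2 - 2 * (1 + lambda) * x1 + lambda)) * (x3 - x1)).
    by rewrite /x3; ring.
  by rewrite E1 Em !subrr mul0r addr0.
set m := _ / _.
have nd : x2 - x1 != 0 by rewrite subr_eq0 eq_sym.
have Em : m * (x2 - x1) = y2 - y1 by rewrite /m divfK.
set x3 := m ^+ 2 + 1 + lambda - x1 - x2.
have {}E2 : (y1 + m * (x2 - x1)) ^+ 2 = x2 * (x2 - 1) * (x2 - lambda).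
  by rewrite Em -E2; congr (_ ^+ 2); ring.
rewrite -subr_eq0 -(mulrI_eq0 _ (mulfI nd)); apply/eqP.
transitivity ((x2 - x3) * (y1 ^+ 2 - x1 * (x1 - 1) * (x1 - lambda)) +
  (x3 - x1) * ((y1 + m * (x2 - x1)) ^+ 2 - x2 * (x2 - 1) * (x2 - lambda))).
  by rewrite /x3; ring.
by rewrite E1 E2 !subrr !mulr0 addr0.
Qed.

Definition legendre_padd (P Q : legendre_pt) : legendre_pt :=
  exist _ (legendre_add (val P) (val Q)) (legendre_add_on (valP P) (valP Q)).

End Legendre.

Section RatTensor.

Variables (A : choiceType) (add : A -> A -> A).

(** For an abelian group (A, add), A (x) Q is the rational vector space on
    generators << a >> (standing for a (x) 1) subject to the relations
    << add a b >> = << a >> + << b >>; the group axioms are not needed to write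
    this presentation down.  [add_rel] is the subspace spanned by the
    relations. *)
Definition add_rel : {pred {freeg A / rat}} :=
  fun v => `[< forall S : {pred {freeg A / rat}}, submod_closed S ->
    (forall a b, << add a b >> - << a >> - << b >> \in S) -> v \in S >].

Lemma add_rel_submod_closed : submod_closed add_rel.
Proof.
split=> [|c u v /asboolP uS /asboolP vS]; apply/asboolP => S clS relS.
  by case: clS.
by case: clS (clS) => _ + clS; apply; [apply: uS | apply: vS].
Qed.

HB.instance Definition _ := GRing.isSubmodClosed.Build rat {freeg A / rat}
  add_rel (GRing.submod_closed_semi add_rel_submod_closed).

Definition rat_tensor : Type := Quotient.quot add_rel.

HB.instance Definition _ := GRing.Zmodule.on rat_tensor.

Let V := {freeg A / rat}.
Local Notation pi := (\pi_rat_tensor%qT : V -> rat_tensor).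

Lemma rat_tensor_piD (u v : V) : pi (u + v) = pi u + pi v.
Proof. exact: Quotient.pi_add. Qed.

Definition rat_tensor_scale (c : rat) (u : rat_tensor) : rat_tensor :=
  pi (c *: (repr u : V)).

Lemma rat_tensor_scale_pi c (v : V) : rat_tensor_scale c (pi v) = pi (c *: v).
Proof.
apply/eqP; rewrite /rat_tensor_scale -Quotient.idealrBE -scalerBr.
by apply: rpredZ; rewrite Quotient.idealrBE reprK.
Qed.

Lemma rat_tensor_scaleA a b u :
  rat_tensor_scale a (rat_tensor_scale b u) = rat_tensor_scale (a * b) u.
Proof.
rewrite -[u]reprK (rat_tensor_scale_pi b (repr u)).
by rewrite (rat_tensor_scale_pi a (b *: _)) (rat_tensor_scale_pi (a * b)) scalerA.
Qed.

Lemma rat_tensor_scale1 : left_id 1 rat_tensor_scale.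
Proof. by move=> u; rewrite -[u]reprK !rat_tensor_scale_pi scale1r. Qed.

Lemma rat_tensor_scaleDr : right_distributive rat_tensor_scale +%R.
Proof.
move=> a u v; rewrite -[u]reprK -[v]reprK.
by rewrite -rat_tensor_piD !rat_tensor_scale_pi scalerDr rat_tensor_piD.
Qed.

Lemma rat_tensor_scaleDl u : {morph rat_tensor_scale^~ u : a b / a + b}.
Proof.
move=> a b; rewrite -[u]reprK.
by rewrite !rat_tensor_scale_pi scalerDl rat_tensor_piD.
Qed.

HB.instance Definition _ := GRing.Zmodule_isLmodule.Build rat rat_tensor
  rat_tensor_scaleA rat_tensor_scale1 rat_tensor_scaleDr rat_tensor_scaleDl.

End RatTensor.

Definition finite_dimensional (V : lmodType rat) : Prop :=
  exists (n : nat) (e : 'I_n -> V), forall v : V,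
  exists c : 'I_n -> rat, v = \sum_(i < n) c i *: e i.

Definition legendre_infinite_rank (F : fieldType) (lambda : F) : Prop :=
  ~ finite_dimensional (rat_tensor (@legendre_padd F lambda)).

(* Main.v *)
(** Take [x] rational: then [x (x - 1) (x - lambda)] is a rational number
    times a square of [K] as soon as [x - lambda] is.  If [P] is a monic
    rational cubic with root [lambda], this holds for the abscissa [x] of the
    double of a point of [y^2 = P(x)]; as [x] is a rational function of the
    abscissa [1/t] of that point, any rational [t] will do.  This gives points
    of [E] with [x] rational and [y = s sqrt(q)], [s] in [K], [q] rational,
    which are defined over [K Qab].

    For [t = 2 l] with [l] a large prime,
    - [l] divides [q] exactly once; if [l] exceeds all the previous values of
      [q], the product of two of the square roots is never in the cubic field
      [K], so that some automorphism over [K] multiplies two given points by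
      different signs;
    - the denominator of [x] is even, and doubling a point multiplies it by [4]
      and an odd factor, so that the points are not torsion.
    A shortest relation between the points is then shortened by combining it
    with its conjugate, so they are independent in the group [E(algC)]. *)

From HB Require Import structures.
Require Import Defs.
From mathcomp Require Import all_boot all_order all_algebra all_fingroup.
From mathcomp Require Import all_solvable all_field.
From mathcomp Require Import generic_quotient boolp freeg ring zify.

Set Implicit Arguments.
Unset Strict Implicit.
Unset Printing Implicit Defensive.

Import GRing.Theory Num.Theory.
Local Open Scope ring_scope.

(** * Proving equations as linear combinations of equations *)

Section LinearCombination.

Variable R : comRingType.
Implicit Types a b c d k : R.

(** Here [c = d] is a combination of known equations, assembled with [eq_add] and [eq_mul]; its
    coefficients are a certificate that [ring] checks in the second premise. *)
Lemma eq_of_eq_sub a b c d : c = d -> a - b = c - d -> a = b.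
Proof. by move=> -> /eqP; rewrite subrr subr_eq0 => /eqP. Qed.

Lemma eq_add a b c d : a = b -> c = d -> a + c = b + d.
Proof. by move=> -> ->. Qed.

Lemma eq_mul k a b : a = b -> k * a = k * b.
Proof. by move=> ->. Qed.

End LinearCombination.

(** * The group law of a Legendre curve *)

Section LegendreGroupLaw.

Variables (F : fieldType) (l : F).
Hypotheses (two_neq0 : 2 != 0 :> F) (l_neq0 : l != 0) (l_neq1 : l != 1).
Implicit Types P Q T U V W : F * F.

Definition point_opp P : F * F := (P.1, - P.2).

Lemma point_oppK : involutive point_opp.
Proof. by case=> x y; rewrite /point_opp /= opprK. Qed.

Lemma eq_point_oppC P Q : (P == point_opp Q) = (Q == point_opp P).
Proof. by rewrite -{1}[P]point_oppK (inj_eq (inv_inj point_oppK)) eq_sym. Qed.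

Local Notation on P := (on_legendre l (Some P)).
Local Notation "P +' Q" := (legendre_add l P Q)
  (at level 50, left associativity).

Lemma on_point_opp P : on (point_opp P) = on P.
Proof. by case: P => x y; rewrite /= sqrrN. Qed.

(** The line of slope [m] through [P] meets the curve in the divisor
    [P] + [Q] + [T]; the last two conditions compare coefficients. *)
Definition secant m P Q T : Prop :=
  [/\ Q.2 = P.2 + m * (Q.1 - P.1), T.2 = P.2 + m * (T.1 - P.1),
      P.1 + Q.1 + T.1 = m ^+ 2 + 1 + l &
      P.1 * Q.1 + P.1 * T.1 + Q.1 * T.1 = l - 2 * m * (P.2 - m * P.1)].

Lemma secantC m P Q T : secant m P Q T -> secant m Q P T.
Proof.
move=> [h1 h2 h3 h4]; split.
- by rewrite h1; ring.
- by rewrite h1 h2; ring.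
- by rewrite -h3; ring.
- apply: (eq_of_eq_sub (eq_add h4 (eq_mul (2 * m) h1))); ring.
Qed.

Lemma secantAC m P Q T : secant m P Q T -> secant m P T Q.
Proof.
by move=> [h1 h2 h3 h4]; split=> //; [rewrite -h3 | rewrite -h4]; ring.
Qed.

Lemma secantN m P Q T :
  secant m P Q T -> secant (- m) (point_opp P) (point_opp Q) (point_opp T).
Proof.
move=> [h1 h2 h3 h4]; split; rewrite /= ?h1 ?h2 ?h3 ?h4; ring.
Qed.

(** The coefficient conditions say that the cubic minus the square of the line is (x - x1)(x - x2)(x
    - x3) up to a constant. As [P] is on the curve the constant is 0, so the difference vanishes at
    [T] too. *)
Lemma secant_on m P Q T : on P -> secant m P Q T -> on T.
Proof.
case: P Q T => [x1 y1] [x2 y2] [x3 y3] /eqP E [/= h1 h2 h3 h4]; apply/eqP.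
rewrite h2.
apply: (eq_of_eq_sub (eq_add E (eq_add (eq_mul (x1 ^+ 2 - x3 ^+ 2) h3)
  (eq_mul (x3 - x1) h4)))); ring.
Qed.

(** The quadratic is the derivative of the cubic, whose roots 0, 1, [l] are distinct. *)
Lemma legendre_smooth x :
  x * (x - 1) * (x - l) = 0 -> 3 * x ^+ 2 - 2 * (1 + l) * x + l != 0.
Proof.
move/eqP; rewrite !mulf_eq0 !subr_eq0 -orbA => /or3P[] /eqP->.
- by have -> : 3 * 0 ^+ 2 - 2 * (1 + l) * 0 + l = l by ring.
- have -> : 3 * 1 ^+ 2 - 2 * (1 + l) * 1 + l = 1 - l by ring.
  by rewrite subr_eq0 eq_sym.
- have -> : 3 * l ^+ 2 - 2 * (1 + l) * l + l = l * (l - 1) by ring.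
  by rewrite mulf_neq0 ?subr_eq0.
Qed.

Lemma secant_add m P Q T : on P -> secant m P Q T ->
  Some P +' Some Q = Some (point_opp T).
Proof.
case: P Q T => [x1 y1] [x2 y2] [x3 y3] /eqP E [/= h1 h2 h3 h4].
have h3' : x3 = m ^+ 2 + 1 + l - x1 - x2.
  by apply: (eq_of_eq_sub h3); ring.
have [x12|x12] /= := eqVneq x1 x2.
  subst x2; have y12 : y2 = y1 by rewrite h1; ring.
  have tgt : 2 * y1 * m = 3 * x1 ^+ 2 - 2 * (1 + l) * x1 + l.
    apply: (eq_of_eq_sub (eq_add h4 (eq_mul (- (2 * x1)) h3))); ring.
  have y1_neq0 : y1 != 0.
    apply/eqP => y0; move: tgt E; rewrite y0 expr0n /= !(mulr0, mul0r) => tgt.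
    by move=> /esym /legendre_smooth; rewrite -tgt eqxx.
  have n2y : 2 * y1 != 0 by rewrite mulf_neq0.
  have -> : (y1 == - y2) = false.
    by rewrite y12 -addr_eq0 -mulr2n -mulr_natl; apply: negPf.
  rewrite -tgt.
  rewrite [2 * y1 * m]mulrC mulfK // /point_opp h2 h3' /= /legendre_chord.
  by congr (Some (_, _)); ring.
have nd : x2 - x1 != 0 by rewrite subr_eq0 eq_sym.
have -> : (y2 - y1) / (x2 - x1) = m.
  by apply: (mulIf nd); rewrite divfK // h1; ring.
by rewrite /legendre_chord /point_opp /= h2 h3'; congr (Some (_, _)); ring.
Qed.

Lemma secant_exists P Q : on P -> on Q -> P != point_opp Q ->
  exists m T, secant m P Q T.
Proof.
case: P Q => [x1 y1] [x2 y2] /eqP E1 /eqP E2; rewrite /point_opp xpair_eqE /=.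
have [x12|x12] /= := eqVneq x1 x2 => [ny|_]; rewrite /secant /=.
  subst x2.
  have y12 : y1 = y2.
    apply/eqP; rewrite -subr_eq0.
    have : (y1 - y2) * (y1 + y2) == 0 by rewrite -subr_sqr E1 E2 subrr.
    by rewrite mulf_eq0 [y1 + y2 == 0]addr_eq0 (negPf ny) orbF.
  subst y2.
  have n2y : 2 * y1 != 0.
    by apply: contra ny; rewrite mulr_natl mulr2n addr_eq0.
  pose m := (3 * x1 ^+ 2 - 2 * (1 + l) * x1 + l) / (2 * y1).
  have Em : 2 * y1 * m = 3 * x1 ^+ 2 - 2 * (1 + l) * x1 + l.
    by rewrite /m mulrC divfK.
  pose x3 := m ^+ 2 + 1 + l - x1 - x1.
  exists m, (x3, y1 + m * (x3 - x1)); split=> //=; rewrite /x3; try by ring.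
  by apply: (eq_of_eq_sub Em); ring.
have nd : x2 - x1 != 0 by rewrite subr_eq0 eq_sym.
pose m := (y2 - y1) / (x2 - x1).
have Em : m * (x2 - x1) = y2 - y1 by rewrite /m divfK.
pose x3 := m ^+ 2 + 1 + l - x1 - x2.
exists m, (x3, y1 + m * (x3 - x1)); split=> //=; try by rewrite /x3; ring.
  by apply: (eq_of_eq_sub (eq_mul (-1) Em)); ring.
apply: (mulfI nd); rewrite /x3.
apply: (eq_of_eq_sub (eq_add (eq_add E2 (eq_mul (-1) E1))
  (eq_mul (y1 + m * (x2 - x1) + y2) Em))).
by ring.
Qed.

Lemma legendre_addp0 (A : option (F * F)) : A +' None = A.
Proof. by case: A => [[x y]|]. Qed.

Lemma legendre_addN_affine P : Some P +' Some (point_opp P) = None.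
Proof. by case: P => x y /=; rewrite !eqxx /= opprK eqxx. Qed.

Lemma legendre_addNl_affine P : Some (point_opp P) +' Some P = None.
Proof. by rewrite -{2}[P]point_oppK; apply: legendre_addN_affine. Qed.

(** The tangent case [U = R] obeys the same formula, so that the proof of
    associativity need not treat it apart. *)
Lemma slope_relation m k P Q U R W : on R -> on P ->
  secant m P Q (point_opp U) -> secant k U R W ->
  (R.2 - P.2 - m * (R.1 - P.1)) * (k + m) = (P.1 - R.1) * (Q.1 - R.1).
Proof.
case: P Q U R W => [x1 y1] [x2 y2] [xu yu] [x3 y3] [xw yw] /eqP E3 /eqP E1.
move=> [/= h1 h2 h3 h4] [/= k1 k2 k3 k4].
have [x3u|x3u] := eqVneq x3 xu.
  subst xu.
  have y3u : yu = y3 by rewrite k1; ring.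
  subst yu.
  have tu : 2 * y3 * k = 3 * x3 ^+ 2 - 2 * (1 + l) * x3 + l.
    apply: (eq_of_eq_sub (eq_add k4 (eq_mul (- (2 * x3)) k3))); ring.
  apply: (eq_of_eq_sub (eq_add tu (eq_add (eq_mul (-1) h4)
    (eq_add (eq_mul (2 * x3) h3) (eq_mul (k - m) h2))))).
  by ring.
have nd : x3 - xu != 0 by rewrite subr_eq0.
apply: (mulfI nd).
(* The cubic minus the square of the line [PQ], evaluated at [R]. The second factor on the left is
   [(k + m) * (x3 - xu)], since [- yu] lies on that line and [k] is the slope of [UR]. *)
have e3 : (y3 - (y1 + m * (x3 - x1))) * (y3 + (y1 + m * (x3 - x1))) =
   (x3 - x1) * (x3 - x2) * (x3 - xu).
  apply: (eq_of_eq_sub (eq_add E3 (eq_add (eq_mul (-1) E1)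
    (eq_add (eq_mul (x3 ^+ 2 - x1 ^+ 2) h3) (eq_mul (x1 - x3) h4))))).
  by ring.
set d := (X in X * (k + m)).
apply: (eq_of_eq_sub (eq_add e3 (eq_add (eq_mul d h2) (eq_mul (- d) k1)))).
by rewrite /d; ring.
Qed.

Lemma legendre_addC_affine P Q : on P -> on Q ->
  Some P +' Some Q = Some Q +' Some P.
Proof.
move=> onP onQ; have [->|PQ] := eqVneq P (point_opp Q).
  by rewrite legendre_addN_affine legendre_addNl_affine.
have [m [T sT]] := secant_exists onP onQ PQ.
by rewrite (secant_add onP sT) (secant_add onQ (secantC sT)).
Qed.

Lemma secant_add_exists P Q : on P -> on Q -> P != point_opp Q ->
  exists m U, [/\ on U, secant m P Q (point_opp U) & Some P +' Some Q = Some U].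
Proof.
move=> onP onQ PQ; have [m [T sT]] := secant_exists onP onQ PQ.
exists m, (point_opp T); rewrite point_oppK (secant_add onP sT); split=> //.
by rewrite on_point_opp (secant_on onP sT).
Qed.

Lemma secant_addK m P Q U : on P -> on Q -> secant m P Q (point_opp U) ->
  Some U +' Some (point_opp P) = Some Q.
Proof.
move=> onP onQ /secantN; rewrite point_oppK => sN.
have onU : on U by apply: secant_on sN; rewrite on_point_opp.
by rewrite (secant_add onU (secantC (secantAC sN))) point_oppK.
Qed.

(** The line [PQ] misses [R] by [(r - m) * (R.1 - Q.1)], so [slope_relation] can be divided by
    [R.1 - Q.1]. Exchanging [P] and [R] changes the sign of the result, which is how [n + r = k + m]
    is obtained below. *)
Lemma slope_cocycle m k P Q U R W : on P -> on R ->
  (R.1 - Q.1) != 0 -> R.2 != P.2 + m * (R.1 - P.1) ->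
  forall r, R.2 = Q.2 + r * (R.1 - Q.1) ->
  secant m P Q (point_opp U) -> secant k U R W ->
  r - m != 0 /\ (r - m) * (k + m) = R.1 - P.1.
Proof.
move=> onP onR nRQ nd r hr sU sW; have [hQ _ _ _] := sU.
have := slope_relation onR onP sU sW.
have -> : R.2 - P.2 - m * (R.1 - P.1) = (r - m) * (R.1 - Q.1).
  by rewrite hr hQ; ring.
move=> E; split; last first.
  by apply: (mulIf nRQ); rewrite mulrAC E; ring.
apply: contraNneq nd => rm; apply/eqP; rewrite hr hQ.
by rewrite (_ : r = m); [ring | apply/eqP; rewrite -subr_eq0 rm].
Qed.

(** [m], [r], [k], [n] are the slopes of the lines used to add [P] and [Q],
    [Q] and [R], [P + Q] and [R], [P] and [Q + R]: associativity comes down to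
    the symmetry [n + r = k + m]. *)
Lemma assoc_of_slopes m r k n P Q R U V W W' : r - m != 0 ->
  (r - m) * (k + m) = R.1 - P.1 -> n + r = k + m ->
  secant m P Q (point_opp U) -> secant r Q R (point_opp V) ->
  secant k U R W -> secant n P V W' -> W = W'.
Proof.
move=> nrm e1 e2 [/= a1 a2 a3 _] [/= b1 b2 b3 _] [/= c1 c2 c3 _] [/= d1 d2 d3 _].
have xW : W.1 = k ^+ 2 - m ^+ 2 + P.1 + Q.1 - R.1.
  by apply: (eq_of_eq_sub (eq_add c3 (eq_mul (-1) a3))); ring.
have xW' : W'.1 = n ^+ 2 - r ^+ 2 + Q.1 + R.1 - P.1.
  by apply: (eq_of_eq_sub (eq_add d3 (eq_mul (-1) b3))); ring.
have E : W.1 = W'.1.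
  apply: (mulfI nrm); rewrite xW xW'.
  have -> : n = k + m - r by rewrite -e2; ring.
  by apply: (eq_of_eq_sub (eq_mul (2 * (r - m)) e1)); ring.
suff E2 : W.2 = W'.2 by case: W W' E E2 {c2 c3 d2 d3 xW xW'} => ? ? [? ?] /= -> ->.
have c2' : W.2 = R.2 + k * (W.1 - R.1) by rewrite c2 c1; ring.
rewrite c2' d2 -E xW b1 a1.
have -> : n = k + m - r by rewrite -e2; ring.
by apply: (eq_of_eq_sub (eq_mul (k - m) e1)); ring.
Qed.

Lemma eq_or_point_opp P Q : on P -> on Q -> P.1 = Q.1 ->
  P = Q \/ P = point_opp Q.
Proof.
case: P Q => [x1 y1] [x2 y2] /eqP E1 /eqP E2 /= x12; subst x2.
have : (y1 - y2) * (y1 + y2) == 0 by rewrite -subr_sqr E1 E2 subrr.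
by rewrite mulf_eq0 subr_eq0 addr_eq0 => /orP[] /eqP->; [left | right].
Qed.

Lemma line_meets_curve m P Q T R : on P -> on R -> secant m P Q T ->
  R.2 = P.2 + m * (R.1 - P.1) -> [|| R == P, R == Q | R == T].
Proof.
case: P Q T R => [x1 y1] [x2 y2] [x3 y3] [x4 y4].
move=> /eqP onP /eqP onR [/= h1 h2 h3 h4] hR.
have : (x4 - x1) * (x4 - x2) * (x4 - x3) = 0.
  apply: (eq_of_eq_sub (eq_add (eq_add (eq_mul (-1) onR) onP)
    (eq_add (eq_add (eq_mul (x1 ^+ 2 - x4 ^+ 2) h3) (eq_mul (x4 - x1) h4))
      (eq_mul (y1 + m * (x4 - x1) + y4) hR)))).
  ring.
move/eqP; rewrite !mulf_eq0 !subr_eq0 -orbA !xpair_eqE.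
case/or3P => /eqP e; subst x4.
- by have -> : y4 = y1 by [rewrite hR; ring]; rewrite !eqxx.
- by have -> : y4 = y2 by [rewrite hR h1]; rewrite !eqxx orbT.
- by have -> : y4 = y3 by [rewrite hR h2]; rewrite !eqxx !orbT.
Qed.

Lemma legendre_addC (A B : option (F * F)) :
  on_legendre l A -> on_legendre l B -> A +' B = B +' A.
Proof.
by case: A B => [[x1 y1]|] [[x2 y2]|] onA onB //; apply: legendre_addC_affine.
Qed.

Lemma legendre_addNKl P Q : on P -> on Q ->
  Some (point_opp P) +' (Some P +' Some Q) = Some Q.
Proof.
move=> onP onQ; have [->|PQ] := eqVneq P (point_opp Q).
  by rewrite point_oppK legendre_addNl_affine legendre_addp0.
have [m [U [onU sU ->]]] := secant_add_exists onP onQ PQ.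
by rewrite (legendre_addC_affine _ onU) ?on_point_opp // (secant_addK onP onQ sU).
Qed.

Lemma secant_third P Q R : on P -> on Q -> on R -> P != point_opp Q ->
  Some P +' Some Q = Some (point_opp R) -> Some Q +' Some R = Some (point_opp P).
Proof.
move=> onP onQ onR PQ; have [m [U [onU sU ->]]] := secant_add_exists onP onQ PQ.
case=> UR; rewrite UR point_oppK in sU.
exact: (secant_add onQ (secantAC (secantC sU))).
Qed.

Lemma legendre_add_assoc_neq P Q R : on P -> on Q -> on R -> Q != R ->
  (Some P +' Some Q) +' Some R = Some P +' (Some Q +' Some R).
Proof.
move=> onP onQ onR QR.
have [PNQ|PNQ] := eqVneq P (point_opp Q).
  rewrite PNQ legendre_addNKl //.
  by rewrite legendre_addNl_affine.
have [QNR|QNR] := eqVneq Q (point_opp R).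
  have -> : Some Q +' Some R = None.
    by rewrite QNR legendre_addNl_affine.
  rewrite (legendre_addC_affine onP onQ) legendre_addC ?legendre_add_on //.
  by rewrite -[R in LHS]point_oppK -QNR legendre_addNKl ?legendre_addp0.
have [->|PR] := eqVneq P R.
  by rewrite legendre_addC ?legendre_add_on // (legendre_addC_affine onR onQ).
have [m [U [onU sU aU]]] := secant_add_exists onP onQ PNQ.
have [r [V [onV sV aV]]] := secant_add_exists onQ onR QNR.
have [UNR|UNR] := eqVneq U (point_opp R).
  have -> : Some Q +' Some R = Some (point_opp P).
    by apply: secant_third; rewrite // aU UNR.
  by rewrite aU legendre_addN_affine UNR legendre_addNl_affine.
have [VNP|VNP] := eqVneq P (point_opp V).
  have -> : Some P +' Some Q = Some (point_opp R).
    rewrite legendre_addC_affine //; apply: secant_third; rewrite // 1?eq_point_oppC //.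
    by rewrite legendre_addC_affine // aV VNP point_oppK.
  by rewrite aV VNP !legendre_addNl_affine.
rewrite aU aV.
have [k [W [onW sW ->]]] := secant_add_exists onU onR UNR.
have [n [W' [onW' sW' ->]]] := secant_add_exists onP onV VNP.
have neq_x A B : on A -> on B -> A != B -> A != point_opp B -> B.1 - A.1 != 0.
  move=> onA onB AB ANB; rewrite subr_eq0 eq_sym.
  by apply/eqP => /(eq_or_point_opp onA onB) [] /eqP; rewrite ?(negPf AB) ?(negPf ANB).
have nRQ := neq_x _ _ onQ onR QR QNR.
have [hR _ _ _] := sV.
have nl : R.2 != P.2 + m * (R.1 - P.1).
  apply/eqP => /(line_meets_curve onP onR sU).
  rewrite eq_sym (negPf PR) eq_sym (negPf QR) /= => /eqP e.
  by rewrite e point_oppK eqxx in UNR.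
have [nrm erm] := slope_cocycle onP onR nRQ nl hR sU sW.
suff e : n + r = k + m.
  by have := assoc_of_slopes nrm erm e sU sV sW sW'; move=> /(inv_inj point_oppK) ->.
apply: (mulfI nrm); rewrite erm.
(* For distinct [P] and [Q], [slope_cocycle] with [P] and [R] exchanged gives
   [(m - r) * (n + r) = P.1 - R.1]. *)
have [PQ|PQ] := eqVneq P Q; last first.
  have nPQ : P.1 - Q.1 != 0 by apply: neq_x => //;
    [rewrite eq_sym | rewrite eq_point_oppC].
  have [hQ _ _ _] := secantC sU.
  have nl' : P.2 != R.2 + r * (P.1 - R.1).
    have [hr ht e1 e2] := secantC sV; apply/eqP.
    move/(line_meets_curve onR onP (secantC sV)).
    by rewrite (negPf PR) (negPf PQ) (negPf VNP).
  have [_ e2] := slope_cocycle onR onP nPQ nl' hQ (secantC sV) (secantC sW').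
  by apply: (eq_of_eq_sub (eq_mul (-1) e2)); ring.
(* For [P = Q] the division by [P.1 - Q.1] is impossible; the same relation is read off the
   coefficient conditions after multiplying by [V.1 - P.1]. *)
subst Q; have [_ _ e3 e4] := sU; have [_ hv f3 f4] := sV.
have [g1 _ _ _] := sW'.
have nPV : V.1 - P.1 != 0.
  apply: neq_x => //; apply/eqP => e; subst V; have [h' _ _ _] := secantAC sV.
  have y0 : P = point_opp P.
    by case: (P) h' => x y /= h'; rewrite /point_opp /= h'; congr (_, _); ring.
  by rewrite -y0 eqxx in PNQ.
apply: (mulIf nPV); rewrite /= in e3 e4 hv f3 f4.
apply: (eq_of_eq_sub (eq_add (eq_mul (m - r) (eq_add g1 hv))
  (eq_add (eq_add e4 (eq_mul (-1) f4))
    (eq_mul (2 * P.1) (eq_add f3 (eq_mul (-1) e3)))))).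
ring.
Qed.

Lemma legendre_addA (A B C : option (F * F)) :
    on_legendre l A -> on_legendre l B -> on_legendre l C ->
  A +' (B +' C) = (A +' B) +' C.
Proof.
case: A B C => [P|] [Q|] [R|] //; rewrite ?legendre_addp0 // => onP onQ onR.
have [->|QR] := eqVneq Q R; last by rewrite legendre_add_assoc_neq.
have [->|PR] := eqVneq P R.
  by rewrite legendre_addC ?legendre_add_on.
(* Commutativity moves [P] to the end, so that the last two summands become distinct. *)
rewrite (legendre_addC_affine onP onR) [LHS]legendre_addC ?legendre_add_on //.
rewrite [RHS]legendre_addC ?legendre_add_on //.
by rewrite legendre_add_assoc_neq // 1?eq_sym // (legendre_addC_affine onP onR).
Qed.
End LegendreGroupLaw.

Section LegendreGroup.

Variables (F : fieldType) (l : F).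

(** The smoothness conditions are parameters of the type, so that the group
    structure can be inferred from it. *)
Definition legendre_group (two_neq0 : 2 != 0 :> F) (l_neq0 : l != 0)
  (l_neq1 : l != 1) : Type := legendre_pt l.

Variables (two_neq0 : 2 != 0 :> F) (l_neq0 : l != 0) (l_neq1 : l != 1).

Local Notation E := (legendre_group two_neq0 l_neq0 l_neq1).

HB.instance Definition _ := Choice.on E.

Lemma legendre_opp_on A :
  on_legendre l A -> on_legendre l (omap (@point_opp F) A).
Proof. by case: A => [P|] //; rewrite [omap _ _]/= on_point_opp. Qed.

Definition legendre_zero : E := exist (on_legendre l) None isT.
Definition legendre_opp (P : E) : E :=
  exist (on_legendre l) _ (legendre_opp_on (valP (P : legendre_pt l))).

Fact legendre_paddA : associative (@legendre_padd F l : E -> E -> E).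
Proof. by move=> P Q R; apply: val_inj; apply: legendre_addA; rewrite ?valP. Qed.

Fact legendre_paddC : commutative (@legendre_padd F l : E -> E -> E).
Proof. by move=> P Q; apply: val_inj; apply: legendre_addC; rewrite ?valP. Qed.

Fact legendre_padd0 : left_id legendre_zero (@legendre_padd F l : E -> E -> E).
Proof. by move=> P; apply: val_inj. Qed.

Fact legendre_paddN :
  left_inverse legendre_zero legendre_opp (@legendre_padd F l : E -> E -> E).
Proof.
by move=> [[P|] onP]; apply: val_inj => //; apply: legendre_addNl_affine.
Qed.

HB.instance Definition _ := GRing.isZmodule.Build E
  legendre_paddA legendre_paddC legendre_padd0 legendre_paddN.

End LegendreGroup.

(** * Functoriality of the curve in the field *)

Section FieldMorphism.

Variables (F F' : fieldType) (f : {rmorphism F -> F'}) (l : F) (l' : F').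
Hypothesis fl : f l = l'.

Definition legendre_map : option (F * F) -> option (F' * F') :=
  omap (fun P => (f P.1, f P.2)).

Lemma legendre_map_on A :
  on_legendre l A -> on_legendre l' (legendre_map A).
Proof.
case: A => [[x y]|] //= /eqP E.
by rewrite -fl -rmorphXn E !rmorphM !rmorphB rmorph1.
Qed.

Lemma legendre_map_chord m x y z : legendre_map (legendre_chord l m x y z) =
  legendre_chord l' (f m) (f x) (f y) (f z).
Proof.
rewrite /legendre_chord /= -fl.
by rewrite !(rmorphB, rmorphN, rmorphD, rmorphM, rmorphXn, rmorph1).
Qed.

Lemma legendre_map_add A B : legendre_map (legendre_add l A B) =
  legendre_add l' (legendre_map A) (legendre_map B).
Proof.
case: A B => [[x1 y1]|] [[x2 y2]|] //=.
rewrite (fmorph_eq f) -[- f y2](rmorphN f) (fmorph_eq f).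
case: ifP => _; first by rewrite legendre_map_chord fmorph_div !rmorphB.
case: ifP => // _; rewrite legendre_map_chord fmorph_div.
by rewrite !(rmorph1, rmorph_nat, rmorphB, rmorphD, rmorphM, rmorphXn) fl.
Qed.

Definition legendre_pt_map (P : legendre_pt l) : legendre_pt l' :=
  exist (on_legendre l') _ (legendre_map_on (valP P)).

Lemma legendre_pt_mapD P Q : legendre_pt_map (legendre_padd P Q) =
  legendre_padd (legendre_pt_map P) (legendre_pt_map Q).
Proof. by apply: val_inj; apply: legendre_map_add. Qed.

End FieldMorphism.

(** * Independence and the tensor product with the rationals *)

Section RatTensorInfinite.

Variables (A : choiceType) (add : A -> A -> A) (G : zmodType) (psi : A -> G).
Hypothesis psiD : forall a b, psi (add a b) = psi a + psi b.

Local Notation ratsum s := (\sum_(x <- s) << (x.1%:~R : rat) *g x.2 >>).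
Local Notation intsum s := (\sum_(x <- s) psi x.2 *~ x.1).

(** Integers embed in [rat], so the formal sum already vanishes in the free abelian group on [A], to
    which [psi] extends additively. *)
Lemma intsum_eq0 (s : seq (int * A)) :
  ratsum s = 0 :> {freeg A / rat} -> intsum s = 0.
Proof.
move=> s0; have f0 : [freeg s] = 0 :> {freeg A}.
  apply/eqP/freeg_eqP => z; rewrite coeff0 coeff_Freeg.
  apply: (@intr_inj rat); rewrite rmorph0 -(coeff0 rat z) -s0.
  rewrite raddf_sum /= /precoeff raddf_sum big_mkcond /=.
  by apply: eq_bigr => x _; rewrite coeffU; case: eqP => _; rewrite ?mulr1 ?mulr0.
pose h := fun a => psi a : zmodule G.
have <- : fglift h [freeg s] = intsum s by rewrite fglift_Freeg.
by rewrite f0 -(freeg_nil int A) fglift_Freeg /prelift big_nil.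
Qed.

(** The elements having a nonzero multiple with integral coefficients that is
    killed by the evaluation in [G]. *)
Definition torsion_span : {pred {freeg A / rat}} := fun v => `[< exists (N : int)
  (s : seq (int * A)), [/\ N != 0, N%:~R *: v = ratsum s & intsum s = 0] >].

Definition scale_seq (n : int) (s : seq (int * A)) :=
  [seq (n * x.1, x.2) | x <- s].

Lemma ratsum_scale n s : ratsum (scale_seq n s) = n%:~R *: ratsum s.
Proof.
rewrite big_map scaler_sumr; apply: eq_bigr => x _; apply/eqP/freeg_eqP => z.
by rewrite coeffZ !coeffU mulrA rmorphM.
Qed.

Lemma intsum_scale n s : intsum (scale_seq n s) = intsum s *~ n.
Proof.
rewrite big_map [RHS]mulrz_suml; apply: eq_bigr => x _.
by rewrite mulrC mulrzA.
Qed.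

Lemma torsion_span_submod_closed : submod_closed torsion_span.
Proof.
split=> [|c u v /asboolP[N [s [N0 Es Is]]] /asboolP[M [t [M0 Et It]]]]; apply/asboolP.
  by exists 1, [::]; rewrite !big_nil scaler0.
(* Clears the denominators of [c], [u] and [v] at once. *)
exists (denq c * N * M), (scale_seq (numq c * M) s ++ scale_seq (denq c * N) t).
split.
- by rewrite !mulf_neq0 ?denq_neq0.
- rewrite big_cat /= !ratsum_scale -Es -Et scalerDr !scalerA.
  congr (_ *: _ + _ *: _).
    by rewrite !rmorphM /= numqE; ring.
  by rewrite !rmorphM /=.
- by rewrite big_cat /= !intsum_scale Is It !mul0rz addr0.
Qed.

Lemma torsion_span_rel a b :
  << add a b >> - << a >> - << b >> \in torsion_span.
Proof.
apply/asboolP; exists 1, [:: (1, add a b); (-1, a); (-1, b)]; split=> //.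
  by rewrite !big_cons big_nil /= scale1r addr0 addrA !freegUN.
by rewrite !big_cons big_nil /= addr0 psiD !mulrNz !mulr1z -opprD subrr.
Qed.

(** With [n] generators, the classes of [p 0], ..., [p n] satisfy a rational relation. Its lift lies
    in [add_rel], hence in [torsion_span], so clearing denominators produces an integral relation
    between the [psi (p i)]. *)
Lemma rat_tensor_infinite (p : nat -> A) :
    (forall n (c : 'I_n -> int), \sum_(i < n) psi (p i) *~ c i = 0 ->
      forall i, c i = 0) ->
  ~ finite_dimensional (rat_tensor add).
Proof.
move=> indep [n [e gen_e]].
pose pt : {freeg A / rat} -> rat_tensor add := \pi_(rat_tensor add)%qT.
have [C HC] := choice (fun i : 'I_n.+1 => gen_e (pt << p i >>)).
pose M := \matrix_(i < n.+1, j < n) C i j.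
have : kermx M != 0.
  rewrite kermx_eq0 /row_free; apply/eqP => rM.
  by have := rank_leq_col M; rewrite rM ltnn.
case/rowV0Pn=> u /sub_kermxP uM u_neq0.
have ptD (v w : {freeg A / rat}) : pt (v + w) = pt v + pt w.
  exact: rat_tensor_piD.
have pt0 : pt 0 = 0 by apply: (addIr (pt 0)); rewrite -ptD !add0r.
have ptZ c v : pt (c *: v) = c *: pt v.
  exact: esym (rat_tensor_scale_pi add c v).
have uC j : \sum_i u 0 i * C i j = 0.
  by have /matrixP/(_ 0 j) := uM; rewrite !mxE => E; rewrite -[RHS]E;
    apply: eq_bigr => i _; rewrite mxE.
pose v := \sum_i u 0 i *: << p i >> : {freeg A / rat}.
have pv0 : pt v = 0.
  rewrite /v (big_morph pt ptD pt0).
  under eq_bigr => i _ do rewrite ptZ HC scaler_sumr.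
  rewrite exchange_big /= big1 // => j _.
  by under eq_bigr => i _ do rewrite scalerA; rewrite -scaler_suml uC scale0r.
have v_rel : v \in add_rel add.
  by rewrite -[v]subr0 Quotient.idealrBE; apply/eqP; rewrite -/(pt v) -/(pt 0) pv0 pt0.
have := asboolP _ v_rel _ torsion_span_submod_closed torsion_span_rel.
case/asboolP => N [s [N0 Es Is]].
pose D := \prod_i denq (u 0 i).
have D0 : D != 0 by apply/prodf_neq0 => i _; apply: denq_neq0.
have [d Hd] : exists d : 'I_n.+1 -> int, forall i, D%:~R * u 0 i = (d i)%:~R.
  exists (fun i => \prod_(j | j != i) denq (u 0 j) * numq (u 0 i)) => i.
  by rewrite /D (bigD1 i) //= !rmorphM /= numqE; ring.
have [i ui0] := rV0Pn _ u_neq0.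
(* [D * N] times [v] has two integral expressions: one with coefficients [d k * N] on the [p k], the
   other [D] times [s]. They have the same image in [G], and that of [s] is 0. *)
have dN0 : d i * N = 0.
  apply: (indep _ (fun i => d i * N)).
  pose t := [seq (d k * N, p k) | k : 'I_n.+1].
  have It : intsum t = \sum_(k < n.+1) psi (p k) *~ (d k * N).
    by rewrite big_map big_enum.
  rewrite -It; transitivity (intsum (t ++ scale_seq (- D) s)).
    by rewrite big_cat /= intsum_scale Is mul0rz addr0.
  apply: intsum_eq0; rewrite big_cat /= ratsum_scale -Es big_map big_enum /=.
  apply/eqP/freeg_eqP => z.
  rewrite coeffD coeff0 !coeffZ /v !raddf_sum /= !mulr_sumr -big_split big1 //= => k _.
  by rewrite coeffZ !coeffU !rmorphM /= -Hd rmorphN; ring.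
move/eqP: dN0; rewrite mulf_eq0 (negPf N0) orbF => /eqP di0.
have := Hd i; rewrite di0 => /eqP; rewrite mulf_eq0 intr_eq0 (negPf D0) /=.
by rewrite (negPf ui0).
Qed.

End RatTensorInfinite.

Lemma independent_of_signs (G : zmodType) (p : nat -> G) :
    (forall i m, (0 < m)%N -> p i *+ m != 0) ->
    (forall i j, i != j -> exists (s : {additive G -> G}) (b : nat -> bool),
      (forall k, s (p k) = p k *~ (-1) ^+ b k) /\ b i != b j) ->
  forall n (c : 'I_n -> int), \sum_(i < n) p i *~ c i = 0 -> forall i, c i = 0.
Proof.
move=> tf sep n; suff IH m : forall c : 'I_n -> int,
    (#|[pred i | c i != 0%R]| <= m)%N -> \sum_(i < n) p i *~ c i = 0 ->
    forall i, c i = 0 by move=> c; apply: (IH _ c (leqnn _)).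
elim: m => [|m IHm] c.
  by rewrite leqn0 => /eqP/card0_eq c0 _ i; have := c0 i; rewrite inE => /negbFE/eqP.
move=> le_c rel j; apply/eqP/negPn/negP => cj.
have [i /andP[ij ci]|c0] := pickP [pred i | (i != j) && (c i != 0)]; last first.
  move: rel; rewrite (bigD1 j) //= big1 ?addr0 => [|i ij]; last first.
    by have := c0 i; rewrite /= ij => /negbFE/eqP->.
  have := tf j `|c j|%N; rewrite absz_gt0 cj => /(_ isT).
  by case: (intP (c j)) => [|k|k]; rewrite ?mulrNz ?oppr_eq0 // => /negP h /eqP /=;
    rewrite ?oppr_eq0.
have [s [b [sp bij]]] := sep i j ij.
(* The coefficients of the image of the relation under [s] minus [(-1) ^+ b i] times the relation:
   the one at [i] disappears, the one at [j] is doubled up to sign. *)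
pose c' (k : 'I_n) := ((-1) ^+ b k - (-1) ^+ b i) * c k.
have c'j : c' j != 0.
  rewrite mulf_neq0 // subr_eq0; apply: contra bij.
  by case: (b i) (b j) => [] [].
case/eqP: c'j; apply: IHm.
  rewrite -ltnS; apply: leq_trans le_c; apply: proper_card; apply/properP.
  split; first by apply/subsetP => k; rewrite !inE;
    apply: contra => /eqP E; rewrite /c' E mulr0.
  by exists i; rewrite !inE // /c' subrr mul0r eqxx.
transitivity (s (\sum_(k < n) p k *~ c k) - (\sum_(k < n) p k *~ c k) *~ (-1) ^+ b i).
  rewrite raddf_sum mulrz_suml -sumrB; apply: eq_bigr => k _.
  by rewrite /= raddfMz sp -!mulrzA -mulrzBr /c' mulrBl [c k * _]mulrC.
by rewrite rel raddf0 mul0rz subr0.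
Qed.

(** * Points of infinite order *)

Section AintParity.

Let two_neq0 : 2 != 0 :> algC. Proof. by rewrite pnatr_eq0. Qed.

Definition evenA (z : algC) := z / 2 \in Aint.
(** Congruence to 1 modulo 2 is stronger than not being even, and is stable under products. *)
Definition oddA (z : algC) := evenA (z - 1).

Lemma evenAD x y : evenA x -> evenA y -> evenA (x + y).
Proof. by rewrite /evenA mulrDl; apply: rpredD. Qed.

Lemma evenAM x y : evenA x -> y \in Aint -> evenA (x * y).
Proof. by rewrite /evenA mulrAC => *; apply: rpredM. Qed.

Lemma evenA2 : evenA 2.
Proof. by rewrite /evenA divff. Qed.

Lemma evenA_Aint x : evenA x -> x \in Aint.
Proof. by move=> ex; rewrite -(divfK two_neq0 x) rpredM // (Aint_int 2). Qed.

Lemma evenAN x : evenA x -> evenA (- x).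
Proof. by rewrite -mulrN1 => /evenAM; apply; rewrite rpredN. Qed.

Lemma oddA_Aint x : oddA x -> x \in Aint.
Proof. by move/evenA_Aint => h; rewrite -(subrK 1 x) rpredD. Qed.

Lemma oddAM x y : oddA x -> oddA y -> oddA (x * y).
Proof.
move=> ox oy; rewrite /oddA.
have -> : x * y - 1 = (x - 1) * y + (y - 1) by ring.
exact: evenAD (evenAM ox (oddA_Aint oy)) oy.
Qed.

Lemma oddA1 : oddA 1.
Proof. by rewrite /oddA /evenA subrr mul0r. Qed.

Lemma oddAB x y : oddA x -> evenA y -> oddA (x - y).
Proof. by move=> ox ey; rewrite /oddA addrAC; apply: evenAD => //; apply: evenAN. Qed.

(** Otherwise 1/2 would be a rational algebraic integer. *)
Lemma oddA_even x : oddA x -> evenA x -> False.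
Proof.
move=> ox ex; have : evenA 1.
  have -> : 1 = x - (x - 1) by ring.
  by apply: evenAD => //; apply: evenAN.
rewrite /evenA mul1r => /Cint_rat_Aint h.
have /intrP[m Em] : (2^-1 : algC) \is a Num.int.
  by apply: h; rewrite rpredV (rpred_nat _ 2).
have : (2 * m)%:~R = 1%:~R :> algC by rewrite rmorphM /= -Em divff.
by move/intr_inj; lia.
Qed.

Lemma oddA_neq0 x : oddA x -> x != 0.
Proof.
by move=> ox; apply/eqP => x0; apply: (oddA_even ox); rewrite /evenA x0 mul0r.
Qed.

End AintParity.

Section NonTorsion.

Variables (l : algC) (two_neq0 : 2 != 0 :> algC) (l_neq0 : l != 0)
  (l_neq1 : l != 1).
Local Notation E := (legendre_group two_neq0 l_neq0 l_neq1).

(** [X] is a unit and [Z] a multiple of [2] in the localization at [2] of the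
    ring of algebraic integers: doubling [P] preserves this and multiplies [Z]
    by [4] times a unit. *)
Definition has_abscissa (P : E) (X Z : algC) :=
  [/\ oddA X, evenA Z, evenA (l * Z), Z != 0 &
    exists y, val (P : legendre_pt l) = Some (X / Z, y)].

(** The duplication formula x(2P) = (x^2 - l)^2 / (4 x (x - 1)(x - l)), homogenized by x = X / Z. *)
Lemma has_abscissa_double P X Z : has_abscissa P X Z ->
  exists X' u, oddA u /\ has_abscissa (P + P) X' (Z * (4 * u)).
Proof.
move=> [oX eZ elZ Z0 [y vP]].
exists ((X ^+ 2 - l * Z * Z) ^+ 2), (X * (X - Z) * (X - l * Z)).
have oXZ : oddA (X - Z) by apply: oddAB.
have oXlZ : oddA (X - l * Z) by apply: oddAB.
have ou : oddA (X * (X - Z) * (X - l * Z)) by do 2 ! apply: oddAM => //.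
have A4 : 4 * (X * (X - Z) * (X - l * Z)) \in Aint.
  by apply: rpredM; [exact: (rpred_nat _ 4) | exact: oddA_Aint].
have [X0 XZ0 XlZ0] := And3 (oddA_neq0 oX) (oddA_neq0 oXZ) (oddA_neq0 oXlZ).
split=> //; split.
- by rewrite expr2; apply: oddAM;
    (apply: oddAB; [apply: oddAM | apply: evenAM => //; apply: evenA_Aint]).
- exact: evenAM.
- by rewrite mulrA; apply: evenAM.
- by rewrite !mulf_neq0 // pnatr_eq0.
have /= := valP (P : legendre_pt l); rewrite vP => /eqP yE.
have y0 : y != 0.
  have : y ^+ 2 != 0.
    rewrite yE; have -> : X / Z * (X / Z - 1) * (X / Z - l) =
      X * (X - Z) * (X - l * Z) / Z ^+ 3 by field.
    by rewrite !mulf_neq0 ?invr_eq0 ?expf_neq0.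
  by rewrite expf_eq0.
suff [y' dP] : exists y', legendre_add l (Some (X / Z, y)) (Some (X / Z, y)) =
    Some ((X ^+ 2 - l * Z * Z) ^+ 2 /
      (Z * (4 * (X * (X - Z) * (X - l * Z)))), y').
  by exists y'.
rewrite /= eqxx /=.
have -> : (y == - y) = false.
  by rewrite -addr_eq0 -mulr2n -mulr_natl mulf_eq0 (negPf two_neq0) (negPf y0).
eexists; congr (Some (_, _)).
set x := X / Z in yE *.
have -> : ((3 * x ^+ 2 - 2 * (1 + l) * x + l) / (2 * y)) ^+ 2 =
  (3 * x ^+ 2 - 2 * (1 + l) * x + l) ^+ 2 / (4 * (x * (x - 1) * (x - l))).
  by rewrite -yE; field; rewrite y0.
rewrite /x; field.
by rewrite XlZ0 XZ0 X0.
Qed.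

Lemma has_abscissa_exp2 P X Z k : has_abscissa P X Z ->
  exists X' u, oddA u /\ has_abscissa (P *+ (2 ^ k)) X' (Z * (4 ^+ k * u)).
Proof.
move=> hP; elim: k => [|k [X' [u [ou hk]]]].
  by exists X, 1; split; [exact: oddA1 | rewrite expr0 !mulr1].
have [X'' [v [ov hv]]] := has_abscissa_double hk.
exists X'', (u * v); split; first exact: oddAM.
have -> : Z * (4 ^+ k.+1 * (u * v)) = Z * (4 ^+ k * u) * (4 * v).
  by rewrite exprS; ring.
by rewrite expnS mul2n -addnn mulrnDr.
Qed.

Lemma has_abscissa_nontorsion P X Z m :
  has_abscissa P X Z -> (0 < m)%N -> P *+ m != 0.
Proof.
move=> hP m_gt0; apply/eqP => Pm.
have [b co_b mE] := pfactor_coprime (isT : prime 2) m_gt0; set a := logn 2 m in mE.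
have b_gt0 : (0 < b)%N by case: (b) mE m_gt0 => // ->.
(* By Euler's theorem the difference of the two powers of 2 is a multiple of [b * 2 ^ a], which is
   [m]. *)
have Eab : P *+ (2 ^ (a + totient b)) = P *+ (2 ^ a).
  have /eqP := Euler_exp_totient co_b; rewrite eqn_mod_dvd ?expn_gt0 //.
  case/dvdnP => q Eq.
  have -> : (2 ^ (a + totient b) = m * q + 2 ^ a)%N.
    have : (0 < 2 ^ totient b)%N by rewrite expn_gt0.
    by rewrite expnD mE; nia.
  by rewrite mulrnDr mulrnA Pm mul0rn add0r.
have [X1 [u1 [ou1 [oX1 _ _ _ [y1 v1]]]]] := has_abscissa_exp2 (a + totient b) hP.
have [X2 [u2 [ou2 [oX2 _ _ _ [y2 v2]]]]] := has_abscissa_exp2 a hP.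
rewrite Eab v2 in v1; case: v1 => + _.
have [_ _ _ Z0 _] := hP.
have u10 := oddA_neq0 ou1; have u20 := oddA_neq0 ou2.
have p4 k : (4 : algC) ^+ k != 0 by rewrite expf_neq0 // pnatr_eq0.
move=> /eqP; rewrite eqr_div ?mulf_neq0 // => /eqP E.
(* Equating the two abscissas gives X1 u2 = 4^totient(b) X2 u1: an odd number equal to an even
   one. *)
apply: (@oddA_even (X1 * u2)); first exact: oddAM.
have -> : X1 * u2 = 2 * (2 * 4 ^+ (totient b).-1 * (X2 * u1)).
  apply: (mulIf (mulf_neq0 Z0 (p4 a))).
  transitivity (X1 * (Z * (4 ^+ a * u2))); first by ring.
  by rewrite -E -[totient b in LHS]prednK ?totient_gt0 // exprD exprS; ring.
apply: evenAM; first exact: evenA2.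
by rewrite !rpredM ?rpredX ?(oddA_Aint oX2, oddA_Aint ou1) //;
  [exact: (rpred_nat _ 2) | exact: (rpred_nat _ 4)].
Qed.

End NonTorsion.

(** * Square roots of rationals *)

Lemma poly_over_rat (L : fieldExtType rat) (f : {rmorphism L -> algC})
    (p : {poly L}) : p \is a polyOver 1%VS ->
  exists q : {poly rat}, map_poly f p = map_poly ratr q.
Proof.
move/polyOver1P => [q ->]; exists q; rewrite -map_poly_comp.
by apply: eq_map_poly => a; rewrite /= alg_num_field fmorph_rat.
Qed.

(** As z is not in Q(x), its minimal polynomial there is X^2 - N. So z can be sent to -z by an
    automorphism of Q(x, z) fixing x, which extends to [algC]. *)
Lemma conjugate_sqrt (x z : algC) (N : rat) : z ^+ 2 = ratr N ->
    (forall p : {poly rat}, z != (map_poly ratr p).[x]) ->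
  exists nu : {rmorphism algC -> algC}, nu x = x /\ nu z = - z.
Proof.
move=> zN zx; have [L [f [[|x1 [|z1 []]] // [fx fz] genL]]] := num_field_exists [:: x; z].
pose E := <<1; x1>>%AS.
have z1E : z1 \notin E.
  apply/negP => /Fadjoin_polyP[p /(poly_over_rat f)[q pq] z1E].
  by case/eqP: (zx q); rewrite -fz -fx z1E -pq horner_map.
have z1N : z1 ^+ 2 = N%:A.
  by apply: (fmorph_inj f); rewrite rmorphXn /= fz zN alg_num_field fmorph_rat.
have pE : 'X^2 - (N%:A)%:P \is a polyOver E.
  by rewrite rpredB ?rpredX ?polyOverX // polyOverC rpredZ ?rpred1.
have min_z1 : minPoly E z1 %| 'X^2 - (N%:A)%:P.
  by apply: minPoly_dvdp => //; rewrite rootE !hornerE z1N subrr.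
have root_opp : root (minPoly E z1) (- z1).
  have /eqp_root -> : minPoly E z1 %= 'X^2 - (N%:A)%:P.
    rewrite -(dvdp_size_eqp min_z1) size_minPoly size_XnsubC // eqSS.
    rewrite eqn_leq; apply/andP; split.
      have := dvdp_leq _ min_z1; rewrite size_minPoly size_XnsubC //; apply.
      by rewrite -size_poly_gt0 size_XnsubC.
    by rewrite ltn_neqAle eq_sym adjoin_deg_eq1 z1E.
  by rewrite rootE !hornerE sqrrN z1N subrr.
pose phi := kHomExtend E \1 z1 (- z1).
have root1 : root (map_poly \1%VF (minPoly E z1)) (- z1) by rewrite lfun1_poly.
have hom1 : kHom E E (\1%VF : 'End(L)) by rewrite kHom1.
have phim : monoid_morphism phi.
  apply/kHom_monoid_morphism; apply: (@kHomSl _ _ 1%AS E); first exact: sub1v.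
  rewrite -genL adjoin_cons adjoin_seq1.
  exact: kHomExtendP.
pose phimM := GRing.isMonoidMorphism.Build _ _ phi phim.
pose phiRM : {rmorphism _ -> _} := HB.pack (fun_of_lfun phi) phimM.
have [nu Dnu] := extend_algC_subfield_aut f phiRM.
exists nu; rewrite -fx -fz -!Dnu /= -rmorphN; split; congr (f _).
  by rewrite /phi kHomExtend_id ?lfunE //= memv_adjoin.
by rewrite /phi (kHomExtend_val hom1).
Qed.

Lemma galois_char0 (S : splittingFieldType rat) : galois 1%AS {:S}.
Proof.
apply/and3P; split; first exact: sub1v.
  apply/allP => y _; apply: pcharf0_separable => p.
  by rewrite (pchar_lalg S) pchar_num.
apply/splitting_normalField; first exact: sub1v.
by have [p pE sp] := splittingFieldP S; exists p.
Qed.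

(** An automorphism is determined by its value at [z], which is [z] or [- z]; sign changes
    commute. *)
Lemma quadratic_abelian (S : splittingFieldType rat) (z : S) (N : rat) :
  <<1; z>>%VS = fullv -> z ^+ 2 = N%:A -> abelian 'Gal({:S} / 1%AS).
Proof.
move=> genS zN.
have gal_z (s : gal_of {:S}) : s z = z \/ s z = - z.
  have : s z ^+ 2 == z ^+ 2 by rewrite -(rmorphXn s) /= zN linearZ /= rmorph1.
  by rewrite eqf_sqr => /orP[] /eqP; [left | right].
apply/centsP => s _ t _; apply/eqP/gal_eqP => y _.
have /Fadjoin_polyP[p /polyOver1P[q ->] ->] : y \in <<1; z>>%VS.
  by rewrite genS memvf.
have gal_p (r : gal_of {:S}) (w : S) :
    r (map_poly (in_alg S) q).[w] = (map_poly (in_alg S) q).[r w].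
  rewrite -(horner_map r) -map_poly_comp; congr (_.[_]).
  by apply: eq_map_poly => c /=; rewrite linearZ /= rmorph1.
rewrite !galM ?memvf // !gal_p.
have galN (r : gal_of {:S}) (w : S) : r (- w) = - r w by rewrite rmorphN.
by case: (gal_z s) (gal_z t) => sE [] tE; rewrite ?(sE, tE, galN).
Qed.

Lemma sqrt_rat_Qab (z : algC) (N : rat) : z ^+ 2 = ratr N -> z \in Qab.
Proof.
move=> zN; have [L [f [[|z1 []] // [fz] genL]]] := num_field_exists [:: z].
have z1N : z1 ^+ 2 = N%:A.
  by apply: (fmorph_inj f); rewrite rmorphXn /= fz zN alg_num_field fmorph_rat.
have NE : 'X^2 - (N%:A)%:P = ('X - z1%:P) * ('X - (- z1)%:P) :> {poly L}.
  by rewrite -z1N rmorphXn rmorphN /=; ring.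
have splitL : SplittingField.axiom L.
  exists ('X^2 - (N%:A)%:P).
    by rewrite rpredB ?rpredX ?polyOverX // polyOverC rpredZ ?rpred1.
  exists [:: z1; - z1]; first by rewrite NE !big_cons big_nil mulr1 eqpxx.
  apply/eqP; rewrite eqEsubv subvf -genL adjoin_seqSr // => y.
  by rewrite !inE => /eqP->; rewrite eqxx.
pose S : splittingFieldType rat := HB.pack L
  (FieldExt_isSplittingField.Build rat L splitL).
apply/asboolP; exists S, f; split; first exact: galois_char0.
  by apply: (@quadratic_abelian S z1 N) => //; rewrite -adjoin_seq1.
by apply/asboolP; exists z1.
Qed.

Lemma sparse_primes (m : nat) (f : nat -> nat) : exists ell : nat -> nat,
  (forall j, prime (ell j) /\ (m < ell j)%N) /\
  (forall i j, (i < j)%N -> (f (ell i) < ell j)%N).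
Proof.
pose next k := s2val (prime_above k).
have nextP k : (k < next k)%N && prime (next k).
  by apply/andP; split;
    [exact: (s2valP (prime_above k)) | exact: (s2valP' (prime_above k))].
(* The summand [ell i] makes the sequence increase, so that [f (ell i)] stays below all later
   terms. *)
pose ell := fix ell j :=
  if j is i.+1 then next (ell i + f (ell i) + m)%N else next m.
have ellS i : (ell i + f (ell i) + m < ell i.+1)%N.
  by case/andP: (nextP (ell i + f (ell i) + m)%N).
exists ell; split.
  case=> [|j]; first by case/andP: (nextP m).
  split; first by case/andP: (nextP (ell j + f (ell j) + m)%N).
  by apply: leq_ltn_trans (ellS j); rewrite leq_addl.
move=> i j; elim: j => // j IH; rewrite ltnS leq_eqVlt => /orP[/eqP->|/IH lt_ij];
  have := ellS j; lia.
Qed.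

(** * Integral parametrization *)

Section Family.

Variables (M a b c : int).

(** With [P = T^3 - a T^2 - b T - c], one has [t^3 P(1/t) = twist_p t], and
    [twist_X t / (4 t twist_p t)] is the abscissa of the double of the point of
    abscissa [1/t] of [y^2 = P(x)]; it is divided by [M] since [P] is the
    polynomial of [M lambda].  [twist_Q] is one quarter of [X (X - Z) Z]. *)
Definition twist_p (t : int) := 1 - a * t - b * t ^+ 2 - c * t ^+ 3.
Definition twist_X (t : int) :=
  (1 + b * t ^+ 2) ^+ 2 + 8 * c * t ^+ 3 - 4 * a * c * t ^+ 4.
Definition twist_Z (t : int) := 4 * M * t * twist_p t.
Definition twist_Q (t : int) :=
  M * t * twist_p t * twist_X t * (twist_X t - twist_Z t).

Lemma twist_XE t : exists u, twist_X t = 1 + t * u.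
Proof.
exists (2 * b * t + b ^+ 2 * t ^+ 3 + 8 * c * t ^+ 2 - 4 * a * c * t ^+ 3).
by rewrite /twist_X; ring.
Qed.

(** Each factor is 1 modulo [t], so a prime dividing [t] can divide [twist_Q] only through
    [M * t]. *)
Lemma twist_unit t : exists u,
  twist_p t * twist_X t * (twist_X t - twist_Z t) = 1 + t * u.
Proof.
have [u1 E1] : exists u, twist_p t = 1 + t * u.
  by exists (- a - b * t - c * t ^+ 2); rewrite /twist_p; ring.
have [u2 E2] := twist_XE t.
have -> : twist_X t - twist_Z t = 1 + t * (u2 - 4 * M * twist_p t).
  by rewrite E2 /twist_Z; ring.
rewrite E1 E2; set v := u2 - _.
by exists ((u1 + u2 + t * u1 * u2) + v + t * (u1 + u2 + t * u1 * u2) * v); ring.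
Qed.

Lemma twist_Q_neq0 t : M != 0 -> (1 < `|t|)%N -> twist_Q t != 0.
Proof.
move=> M0 t1; have [u Eu] := twist_unit t.
have -> : twist_Q t = M * t * (1 + t * u) by rewrite -Eu /twist_Q; ring.
rewrite !mulf_neq0 //; first by apply: contraTneq t1 => ->.
apply/eqP => /eqP; rewrite addrC addr_eq0 => /eqP/(congr1 absz)/eqP.
by rewrite abszM abszN muln_eq1 => /andP[/eqP t_1 _]; rewrite t_1 in t1.
Qed.

(** The bounds on [ell] keep it from dividing [q] or [2 * M], so it divides the product exactly
    once, whereas a square has even valuation. *)
Lemma twist_Q_nonsquare (ell : nat) (q r : int) :
    prime ell -> (2 * `|M| < ell)%N -> M != 0 -> q != 0 -> (`|q| < ell)%N ->
  q * twist_Q (2 * ell%:Z) != r ^+ 2.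
Proof.
move=> pr_ell ltM M0 q0 ltq; apply/eqP => E.
have [u Eu] := twist_unit (2 * ell%:Z).
have EQ : twist_Q (2 * ell%:Z) = ell%:Z * (2 * M * (1 + ell%:Z * (2 * u))).
  by transitivity (M * (2 * ell%:Z) * (1 + 2 * ell%:Z * u));
    [rewrite -Eu /twist_Q; ring | ring].
have ell_dv (x y : int) :
    (ell %| `|(x * y)%R|)%N -> (ell %| `|x|)%N \/ (ell %| `|y|)%N.
  by rewrite abszM Euclid_dvdM // => /orP.
have ell_r : (ell %| `|r|)%N.
  suff : (ell %| `|(r * r)%R|)%N by case/ell_dv.
  by rewrite -expr2 -E EQ mulrCA abszM dvdn_mulr.
have /dvdnP[s Es] := ell_r.
have E2 : `|(q * (2 * M * (1 + ell%:Z * (2 * u))))%R|%N = (s * s * ell)%N.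
  have ell0 : (0 < ell)%N by apply: prime_gt0.
  apply/eqP; rewrite -(eqn_pmul2l ell0); apply/eqP.
  have : `|(q * twist_Q (2 * ell%:Z))%R|%N =
      (ell * `|(q * (2 * M * (1 + ell%:Z * (2 * u))))%R|)%N.
    have -> : q * twist_Q (2 * ell%:Z) =
      ell%:Z * (q * (2 * M * (1 + ell%:Z * (2 * u)))) by rewrite EQ; ring.
    by rewrite abszM.
  by move=> <-; rewrite E expr2 abszM Es; ring.
have : (ell %| `|(q * (2 * M * (1 + ell%:Z * (2 * u))))%R|)%N.
  by rewrite E2 dvdn_mull.
have small (x : nat) : (0 < x)%N -> (x < ell)%N -> (ell %| x)%N -> False.
  by move=> x0 xl /(dvdn_leq x0); rewrite leqNgt xl.
case/ell_dv; first by apply: small => //; rewrite absz_gt0.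
case/ell_dv; first by apply: small; rewrite abszM ?muln_gt0 ?absz_gt0.
move=> dv; have /dvdzP[w Ew] : (ell%:Z %| 1 + ell%:Z * (2 * u))%Z by [].
have : (ell%:Z %| 1)%Z.
  by apply/dvdzP; exists (w - 2 * u); rewrite mulrBl -Ew; ring.
by rewrite dvdz1 => /eqP ell1; rewrite [ell]ell1 in pr_ell.
Qed.
End Family.

(** * Square roots and integral equations in a cubic field *)

Section CubicField.

Variables (K : fieldExtType rat) (cubic : \dim {:K} = 3%N).

Lemma cubic_degree (x : K) :
  adjoin_degree 1%AS x = 1%N \/ adjoin_degree 1%AS x = 3%N.
Proof.
have : (adjoin_degree 1%AS x %| 3)%N.
  rewrite -cubic; have -> : adjoin_degree 1%AS x = \dim <<1; x>>.
    by rewrite dim_Fadjoin dimv1 muln1.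
  exact: field_dimS (subvf _).
by have /primeP[_ div3] := isT : prime 3; case/div3/orP => /eqP->; [left | right].
Qed.

(** The degree of [v] is 1 or 3, and at most 2 because of X^2 - N. *)
Lemma cubic_sqrt (v : K) (N : rat) : v ^+ 2 = N%:A -> v \in 1%VS.
Proof.
move=> vN; rewrite -adjoin_deg_eq1; have [-> //|d3] := cubic_degree v.
have : minPoly 1%AS v %| 'X^2 - (N%:A)%:P.
  apply: minPoly_dvdp; last by rewrite rootE !hornerE vN subrr.
  by rewrite rpredB ?rpredX ?polyOverX // polyOverC rpredZ ?rpred1.
move/dvdp_leq; rewrite size_minPoly d3 size_XnsubC //.
by rewrite -size_poly_gt0 size_XnsubC // => /(_ isT).
Qed.

Lemma cubic_root (x : K) : exists a b c : rat,
  x ^+ 3 = a%:A * x ^+ 2 + b%:A * x + c%:A.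
Proof.
have [q qm [szq qx]] : exists2 q : {poly rat}, q \is monic &
    size q = 4 /\ root (map_poly (in_alg K) q) x.
  have /polyOver1P[q Eq] := minPolyOver 1%AS x.
  have qm : q \is monic by rewrite -(map_monic (in_alg K)) -Eq monic_minPoly.
  have szq : size q = (adjoin_degree 1%AS x).+1.
    by rewrite -(size_map_poly (in_alg K)) -Eq size_minPoly.
  have qx : root (map_poly (in_alg K) q) x by rewrite -Eq root_minPoly.
  have [d1|d3] := cubic_degree x; last by exists q; rewrite // szq d3.
  (* A rational [x] has a linear minimal polynomial, padded here to a cubic. *)
  exists (q * 'X^2); first by rewrite monicMr ?monicXn.
  by rewrite size_Mmonic ?monicXn ?monic_neq0 // szq d1 size_polyXn rmorphM rootM qx.
exists (- q`_2), (- q`_1), (- q`_0); move: qx qm.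
rewrite rootE horner_coef size_map_poly szq !big_ord_recl big_ord0 !coef_map /=.
rewrite /bump /= monicE /lead_coef szq => + /eqP q3; rewrite {}q3.
rewrite !scaleNr scale1r => /eqP E.
apply: (eq_of_eq_sub E); ring.
Qed.

Lemma cubic_integral (x : K) : exists M a b c : int, M != 0 /\
  let x' := M%:~R * x in
  x' ^+ 3 = a%:~R * x' ^+ 2 + b%:~R * x' + c%:~R.
Proof.
have [a [b [c E]]] := cubic_root x.
(* Scaling the root by [M] multiplies [a], [b], [c] by [M], [M ^+ 2], [M ^+ 3], which makes them
   integral. *)
pose M := denq a * denq b * denq c.
exists M, (numq a * denq b * denq c), (M * (numq b * denq a * denq c)),
  (M ^+ 2 * (numq c * denq a * denq b)).
split; first by rewrite !mulf_neq0 ?denq_neq0.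
have h (r : rat) : (numq r)%:~R = r%:A * (denq r)%:~R :> K.
  by rewrite -[LHS](rmorph_int (in_alg K)) numqE rmorphM /= -(rmorph_int (in_alg K)).
rewrite /= !(rmorphM, rmorphXn) /= !h.
apply: (eq_of_eq_sub (eq_mul (((denq a)%:~R * (denq b)%:~R * (denq c)%:~R) ^+ 3) E)).
ring.
Qed.

End CubicField.

(** For a root e of P, the double of a point of y^2 = P(x) has abscissa e + ((x - e)^2 - P'(e))^2 /
    (4 P(x)). This is that identity at abscissa 1/t and e = [x'], cleared of denominators. *)
Lemma twist_square (R : comRingType) (a b c M t : int) (x x' : R) :
  x' = M%:~R * x -> x' ^+ 3 = a%:~R * x' ^+ 2 + b%:~R * x' + c%:~R ->
  (twist_X a b c t)%:~R - x * (twist_Z M a b c t)%:~R =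
  (2 * t%:~R * (1 - a%:~R * t%:~R) * x' + 2 * t%:~R ^+ 2 * x' ^+ 2 -
    (1 + b%:~R * t%:~R ^+ 2)) ^+ 2.
Proof.
move=> x'E E.
have -> : x * (twist_Z M a b c t)%:~R = x' * (4 * t * twist_p a b c t)%:~R.
  by rewrite x'E /twist_Z !rmorphM /=; ring.
rewrite /twist_X /twist_p.
rewrite !(rmorph1, rmorph_nat, rmorphM, rmorphB, rmorphD, rmorphXn) /=.
set A := a%:~R in E *; set B := b%:~R in E *; set C := c%:~R in E *.
set T := t%:~R.
apply: (eq_of_eq_sub (eq_mul
  (- (4 * T ^+ 4 * (x' + A) + 8 * T ^+ 3 * (1 - A * T))) E)).
ring.
Qed.

Lemma twist_4Q (R : comRingType) (M a b c t : int) :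
  4 * (twist_Q M a b c t)%:~R = (twist_X a b c t)%:~R *
    ((twist_X a b c t)%:~R - (twist_Z M a b c t)%:~R) * (twist_Z M a b c t)%:~R :> R.
Proof.
have : 4 * twist_Q M a b c t =
    twist_X a b c t * (twist_X a b c t - twist_Z M a b c t) * twist_Z M a b c t.
  by rewrite /twist_Q /twist_Z; ring.
move: (twist_X _ _ _ _) (twist_Z _ _ _ _ _) (twist_Q _ _ _ _ _) => X Z Q.
by move/(congr1 (fun n : int => n%:~R : R)); rewrite !(rmorphM, rmorphB).
Qed.

(** The right side is X (X - Z) Z S^2 / Z^4, that is, 4 Q S^2 / Z^4. *)
Lemma twisted_point (F : fieldType) (l X Z Q w S : F) : Z != 0 ->
    4 * Q = X * (X - Z) * Z -> X - l * Z = S ^+ 2 -> w ^+ 2 = Q ->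
  (w * (2 * S / Z ^+ 2)) ^+ 2 = X / Z * (X / Z - 1) * (X / Z - l).
Proof.
move=> Z0 QE SE wQ; transitivity (4 * Q * S ^+ 2 / Z ^+ 4).
  by rewrite -wQ; field.
by rewrite QE -SE; field.
Qed.

(** * Infinite rank *)

Section InfiniteRank.

Variables (K : fieldExtType rat) (iota : {rmorphism K -> algC}).
Hypothesis cubic : \dim {:K} = 3%N.
Variable lambda : K.
Hypotheses (lambda_neq0 : lambda != 0) (lambda_neq1 : lambda != 1).

Local Notation F := (KQab iota).
Local Notation l := (iota lambda).

Lemma horner_iota (p : {poly rat}) (x : K) :
  (map_poly ratr p).[iota x] = iota (map_poly (in_alg K) p).[x].
Proof.
rewrite -horner_map -map_poly_comp; congr (_.[_]); apply: eq_map_poly => a /=.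
by rewrite alg_num_field fmorph_rat.
Qed.

(** The values of [p] at [l] lie in the image of [K], where a square root of [N] is rational by
    [cubic_sqrt], hence an integer because it is integral. *)
Lemma sqrt_not_in_K (z : algC) (N : int) : (forall r, N != r ^+ 2) ->
  z ^+ 2 = N%:~R -> forall p : {poly rat}, z != (map_poly ratr p).[l].
Proof.
move=> sqN zN p; apply/eqP; rewrite horner_iota; set v := _.[_] => zv.
have : v \in 1%VS.
  apply: (@cubic_sqrt K cubic v N%:~R); apply: (fmorph_inj iota).
  have -> : (N%:~R)%:A = N%:~R :> K := rmorph_int (in_alg K) N.
  by rewrite rmorphXn /= -zv zN rmorph_int.
case/vlineP => k vk; move: zN; rewrite zv vk alg_num_field fmorph_rat => E.
have : (ratr k : algC) \is a Num.int.
  apply: Cint_rat_Aint; first exact: Crat_rat.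
  apply: (@root_monic_Aint ('X^2 - N%:~R%:P)).
  - by rewrite rootE !hornerE E subrr.
  - exact: monicXnsubC.
  - apply/polyOverP => i; rewrite coefB coefXn coefC.
    by rewrite rpredB ?rpred_nat //; case: ifP => _; rewrite ?rpred_int ?rpred0.
case/intrP => r Er; case/eqP: (sqN r); apply: (@intr_inj algC).
by rewrite -E Er rmorphXn.
Qed.

Lemma algC_two_neq0 : 2 != 0 :> algC.
Proof. by rewrite pnatr_eq0. Qed.

Lemma iota_neq0 : l != 0.
Proof. by rewrite fmorph_eq0. Qed.

Lemma iota_neq1 : l != 1.
Proof. by rewrite fmorph_eq1. Qed.

Local Notation E := (legendre_group algC_two_neq0 iota_neq0 iota_neq1).

Definition to_algC : {rmorphism F -> algC} := \val.

Lemma to_algC_lambda : to_algC (to_KQab iota lambda) = l.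
Proof. by []. Qed.

Definition KQab_to_algC : legendre_pt (to_KQab iota lambda) -> E :=
  legendre_pt_map to_algC_lambda.

Lemma point_exists (x y : algC) : x \in in_compositum (field_image iota) Qab ->
    y \in in_compositum (field_image iota) Qab ->
    y ^+ 2 = x * (x - 1) * (x - l) ->
  exists P : legendre_pt (to_KQab iota lambda),
    val (KQab_to_algC P : legendre_pt l) = Some (x, y).
Proof.
move=> Fx Fy xy.
have onP : on_legendre (to_KQab iota lambda)
    (Some (exist _ x Fx : F, exist _ y Fy : F)).
  by apply/eqP; apply: val_inj.
by exists (exist (on_legendre _) _ onP).
Qed.

Lemma legendre_flip (nu : {rmorphism algC -> algC}) : nu l = l ->
  exists s : {additive E -> E}, forall P : E,
    val (s P : legendre_pt l) = legendre_map nu (val (P : legendre_pt l)).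
Proof.
move=> nul; pose s : E -> E := legendre_pt_map nul.
have sD : {morph s : x y / x + y} by move=> P Q; apply: legendre_pt_mapD.
have sB : zmod_morphism s.
  by move=> P Q; apply/eqP; rewrite eq_sym subr_eq -sD subrK.
pose sA : {additive E -> E} := HB.pack s (GRing.isZmodMorphism.Build _ _ s sB).
by exists sA.
Qed.

Lemma integral_root (a b c : int) (x : algC) :
  x ^+ 3 = a%:~R * x ^+ 2 + b%:~R * x + c%:~R -> x \in Aint.
Proof.
move=> xE; pose q : {poly algC} := Poly [:: - c%:~R; - b%:~R; - a%:~R].
have szq : (size q < size ('X^3 : {poly algC}))%N.
  by rewrite size_polyXn ltnS; apply: size_Poly.
apply: (@root_monic_Aint ('X^3 + q)).
- by rewrite rootE hornerD hornerXn horner_Poly /= xE; apply/eqP; ring.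
- by rewrite monicE lead_coefDl // lead_coefXn.
- apply/polyOverP => i; rewrite coefD coefXn coef_Poly rpredD ?rpred_nat //.
  by case: i => [|[|[|i]]] /=; rewrite ?nth_nil ?rpredN ?rpred_int ?rpred0.
Qed.

Lemma cubic_legendre_infinite_rank :
  legendre_infinite_rank (to_KQab iota lambda).
Proof.
have [M [a [b [c [M0 rel]]]]] := cubic_integral cubic lambda.
pose x' : algC := M%:~R * l.
have {rel} rel : x' ^+ 3 = a%:~R * x' ^+ 2 + b%:~R * x' + c%:~R.
  have := congr1 iota rel.
  by rewrite !(rmorphXn, rmorphD, rmorphM) /= !rmorph_int.
have Ax' := integral_root rel.
pose t (k : nat) : int := 2 * k%:Z.
have [ell [prE sparse]] :=
  sparse_primes (2 * `|M|) (fun k => `|twist_Q M a b c (t k)|%N).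
pose X j := twist_X a b c (t (ell j)).
pose Z j := twist_Z M a b c (t (ell j)).
pose Q j := twist_Q M a b c (t (ell j)).
have Q0 j : Q j != 0.
  apply: twist_Q_neq0 => //; have [/prime_gt1 + _] := prE j.
  by rewrite /t abszM /=; lia.
have Z0 j : Z j != 0.
  by apply: contra (Q0 j) => /eqP; rewrite /Z /twist_Z /Q /twist_Q -!mulrA => /eqP;
    rewrite !mulf_eq0 /=; do !case: (_ == 0).
pose w j := sqrtC ((Q j)%:~R : algC).
have wQ j : w j ^+ 2 = (Q j)%:~R by rewrite sqrtCK.
have w0 j : w j != 0 by have := Q0 j; rewrite -(intr_eq0 algC) -wQ expf_eq0.
pose S j : algC := let T := (t (ell j))%:~R in
  2 * T * (1 - a%:~R * T) * x' + 2 * T ^+ 2 * x' ^+ 2 - (1 + b%:~R * T ^+ 2).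
have SE j : (X j)%:~R - l * (Z j)%:~R = S j ^+ 2 by apply: twist_square.
pose x j : algC := (X j)%:~R / (Z j)%:~R.
pose y j : algC := w j * (2 * S j / (Z j)%:~R ^+ 2).
have onxy j : y j ^+ 2 = x j * (x j - 1) * (x j - l).
  apply: (twisted_point _ (twist_4Q _ M a b c _) (SE j) (wQ j)).
  by rewrite intr_eq0; apply: Z0.
have Fl : l \in in_compositum (field_image iota) Qab.
  by apply: sub_compositum_l; apply: field_image_in.
have Fw j : w j \in in_compositum (field_image iota) Qab.
  apply: sub_compositum_r; apply: (@sqrt_rat_Qab _ (Q j)%:~R).
  by rewrite wQ ratr_int.
have FS j : S j \in in_compositum (field_image iota) Qab.
  by rewrite /S /x' !(rpredB, rpredD, rpredM, rpredX, rpred_int, rpred_nat, rpred1).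
have /choice[p pE] : forall j, exists P,
    val (KQab_to_algC P : legendre_pt l) = Some (x j, y j).
  move=> j; apply: point_exists => //.
    by rewrite /x rpred_div ?rpred_int.
  apply: rpredM => //; apply: rpred_div; last by rewrite rpredX ?rpred_int.
  by apply: rpredM => //; apply: (rpred_nat _ 2).
(* Independence is tested among the points over [algC], on which automorphisms of [algC] fixing [l]
   act. *)
apply: (@rat_tensor_infinite _ _ E KQab_to_algC _ p); first exact: legendre_pt_mapD.
apply: (independent_of_signs (p := fun j => KQab_to_algC (p j))) => [j m m_gt0|i j ij].
  apply: (@has_abscissa_nontorsion _ _ _ _ _ (X j)%:~R (Z j)%:~R) => //.
  have evenT : evenA (t (ell j))%:~R.
    by rewrite /t rmorphM; apply: evenAM (evenA2) (Aint_int _).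
  split.
  - have [u Xu] := twist_XE a b c (t (ell j)).
    rewrite /X Xu /oddA rmorphD rmorph1 addrAC subrr add0r rmorphM.
    exact: evenAM (Aint_int _).
  - have -> : (Z j)%:~R = (t (ell j))%:~R * (4 * M * twist_p a b c (t (ell j)))%:~R :> algC.
      by rewrite -rmorphM /= /Z /twist_Z; congr (_%:~R); ring.
    exact: evenAM (Aint_int _).
  (* The factor [M] of [Z j] turns [l] into the algebraic integer [x'], so [l] itself may have an
     even denominator. *)
  - have -> : l * (Z j)%:~R = (t (ell j))%:~R * (x' * (4 * twist_p a b c (t (ell j)))%:~R).
      by rewrite /x' /Z /twist_Z !rmorphM /=; ring.
    by apply: evenAM => //; apply: rpredM => //; apply: Aint_int.
  - by rewrite intr_eq0.
  - by exists (y j); rewrite pE.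
(* Of the two primes, the one with the larger index exceeds the other value of [Q]. *)
have sqN : forall r, Q i * Q j != r ^+ 2.
  move=> r; wlog lt_ij : i j ij / (i < j)%N => [IH|].
    move: (ij); rewrite neq_ltn => /orP[] lt_ij; first exact: IH.
    by rewrite mulrC; apply: IH => //; rewrite eq_sym.
  have [pr_ell gt_ell] := prE j.
  by apply: twist_Q_nonsquare => //; apply: sparse.
have wN : (w i * w j) ^+ 2 = (Q i * Q j)%:~R by rewrite exprMn !wQ -rmorphM.
have [nu [nul nuw]] : exists nu : {rmorphism algC -> algC},
    nu l = l /\ nu (w i * w j) = - (w i * w j).
  apply: (@conjugate_sqrt _ _ (Q i * Q j)%:~R); first by rewrite wN ratr_int.
  exact: sqrt_not_in_K sqN wN.
have [s sE] := legendre_flip nul.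
have nuS k : nu (S k) = S k.
  rewrite /S /x'.
  rewrite !(rmorph_int, rmorph_nat, rmorph1, rmorphM, rmorphB, rmorphD, rmorphXn).
  by rewrite /= nul.
have nu_w k : nu (w k) = w k \/ nu (w k) = - w k.
  have : nu (w k) ^+ 2 == w k ^+ 2 by rewrite -rmorphXn /= wQ rmorph_int.
  by rewrite eqf_sqr => /orP[] /eqP; [left | right].
have opp_neq (z : algC) : z != 0 -> (- z == z) = false.
  by move=> /negPf z0; rewrite eq_sym -addr_eq0 -mulr2n mulrn_eq0 z0.
have nux k : nu (x k) = x k by rewrite /x fmorph_div !rmorph_int.
have nuy k : nu (y k) = nu (w k) * (2 * S k / (Z k)%:~R ^+ 2).
  by rewrite rmorphM fmorph_div rmorphM rmorphXn rmorph_int rmorph_nat nuS.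
(* [nu] fixes [x k], [S k] and [Z k], so it acts on the k-th point by its sign on [w k]; the signs
   at [i] and [j] differ since [nu] negates [w i * w j]. *)
exists s, (fun k => nu (w k) != w k); split=> [k|].
  have sp : val (s (KQab_to_algC (p k)) : legendre_pt l) = Some (x k, nu (y k)).
    by rewrite sE pE /= nux.
  have [wk|wk] := nu_w k; rewrite wk ?eqxx ?opp_neq //=.
    by apply: (@val_inj _ _ (legendre_pt l)); rewrite sp pE nuy wk.
  apply: (@val_inj _ _ (legendre_pt l)); rewrite sp nuy wk mulNr.
  rewrite expr1 mulrN1z -[RHS]/(omap (@point_opp algC)
    (val (KQab_to_algC (p k) : legendre_pt l))).
  by rewrite pE.
apply/eqP => b_ij; have /eqP := nuw; rewrite rmorphM /=.
have [wi|wi] := nu_w i; have [wj|wj] := nu_w j; move: b_ij;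
  rewrite wi wj ?eqxx ?opp_neq //= ?mulrNN eq_sym opp_neq //;
  by rewrite mulf_neq0.
Qed.

End InfiniteRank.

Theorem theorem6 (K : fieldExtType rat) (iota : {rmorphism K -> algC})
  (cubic : \dim {:K} = 3%N) (lambda : K)
  (lambda_neq0 : lambda <> 0) (lambda_neq1 : lambda <> 1) :
  legendre_infinite_rank (to_KQab iota lambda).
Proof. by apply: cubic_legendre_infinite_rank => //; apply/eqP. Qed.
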